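(* Let $n \ge 1$ and $k \ge 0$ be integers and let $f:\{0,1\}^n \to \{-1,1\}$ be a Boolean function, where $\{0,1\}^n$ is endowed with the uniform measure $\mu_{1/2}$. Suppose that all the Fourier weight of $f$ is concentrated on the first $k$ levels, i.e. $\hat f(S)=0$ for every $S\subset\{1,\ldots,n\}$ with $|S|>k$. Then for every $S \subset \{1,\ldots,n\}$ there is an integer $a(S)\in\mathbb{Z}$ such that \[ \hat f(S) = a(S)\cdot 2^{-k}. \] In particular, $\mathrm{Ent}_{1/2}(f) \le 2k$.
   Context: Elements of $\{0,1\}^n$ are identified with subsets of $\{1,\ldots,n\}$ (a point $x$ corresponds to $\{i: x_i=1\}$). With respect to the uniform measure $\mu_{1/2}$ on $\{0,1\}^n$, the Fourier-Walsh characters are $u_S(T)=(-1)^{|S\cap T|}$ for $S,T\subset\{1,\ldots,n\}$; they form an orthonormal basis, and $\hat f(S)=\mathbb{E}_{\mu_{1/2}}[f\cdot u_S]$, so $f=\sum_S \hat f(S)u_S$. The level of the coefficient $\hat f(S)$ is $|S|$. The spectral entropy is \[ \mathrm{Ent}_{1/2}(f)=\sum_{S\subset\{1,\ldots,n\}} \hat f(S)^2\log\left(\frac{1}{\hat f(S)^2}\right), \] where $\log$ is to base $2$ and terms with $\hat f(S)=0$ are interpreted as $0$. *)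

(* Defs.v *)
From mathcomp Require Import all_boot all_order all_algebra.
From mathcomp Require Import reals exp.
Set Implicit Arguments.
Unset Strict Implicit.
Unset Printing Implicit Defensive.
Import GRing.Theory Num.Theory.
Local Open Scope ring_scope.

(* Coordinates are numbered 0, ..., n-1 rather than 1, ..., n. *)
Definition cube (n : nat) := {ffun 'I_n -> bool}.

(* Identification of points of the cube with subsets of the coordinates. *)
Definition cube_set (n : nat) (x : cube n) : {set 'I_n} := [set i | x i].

(* Expectation with respect to the uniform measure, each point having
   mass 2^-n. *)
Definition unif_expectation (R : realType) (n : nat) (g : cube n -> R) : R :=
  \sum_(x : cube n) 2 ^- n * g x.

Definition walsh (R : realType) (n : nat) (S : {set 'I_n}) (x : cube n) : R :=
  (-1) ^+ #|S :&: cube_set x|.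

Definition fourier_coef (R : realType) (n : nat) (f : cube n -> R)
    (S : {set 'I_n}) : R :=
  unif_expectation (fun x => f x * walsh R S x).

Definition log2 (R : realType) (x : R) : R := ln x / ln 2.

Definition spectral_entropy (R : realType) (n : nat) (f : cube n -> R) : R :=
  \sum_(S : {set 'I_n} | fourier_coef f S != 0)
    fourier_coef f S ^+ 2 * log2 (1 / fourier_coef f S ^+ 2).

(* Main.v *)
(** For [S] with at most [k] elements, the sum of the Fourier coefficients over
    all [T] containing [S] equals [2 ^- #|S|] times an alternating sum of the
    values of [f] on the subsets of [S], hence lies in [2 ^- k * Z].  Descending
    induction on [#|S|] isolates the coefficient at [S].  The nonzero
    coefficients then have squares at least [4 ^- k], and these squares sum to
    [1] by Parseval, which bounds the entropy. *)
Require Import Defs.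
From mathcomp Require Import all_boot all_order all_algebra.
From mathcomp Require Import reals exp.
Import GRing.Theory Num.Theory.
Local Open Scope ring_scope.

Section Walsh.
Variables (R : realType) (n : nat).
Implicit Types (S T : {set 'I_n}) (x y : cube n) (f : cube n -> R).

(** With one factor per coordinate, sums of characters over sets become products of two-term sums by
    distributivity. *)
Lemma walshE S x : walsh R S x = \prod_(i in S) (-1) ^+ x i.
Proof.
rewrite /walsh prodrXr; congr (_ ^+ _).
rewrite -sum1_card (eq_bigl (fun i => (i \in S) && x i)); last first.
  by move=> i; rewrite !inE.
by rewrite -big_mkcondr; apply: eq_bigr => i _; case: (x i).
Qed.

(** Dual orthogonality: coordinate [i] contributes 2 if [x] and [y] agree there and [-1 + 1 = 0]
    otherwise, so one disagreement kills the product. *)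
Lemma sum_walsh_mul x y :
  \sum_S walsh R S x * walsh R S y = if x == y then 2 ^+ n else 0.
Proof.
transitivity (\prod_(i < n) ((-1) ^+ x i * (-1) ^+ y i + 1) : R).
  rewrite bigA_distr; apply: eq_bigr => S _.
  rewrite !walshE -big_split [LHS]big_mkcond /=; apply: eq_bigr => i _.
  by case: (i \in S).
have [->|neq_xy] := eqVneq x y.
  rewrite (eq_bigr (fun=> 2)) ?prodr_const ?card_ord // => i _.
  by rewrite -expr2 sqrr_sign.
have [i neq_i] : exists i, x i != y i.
  apply/existsP; rewrite -negb_forall; apply: contra neq_xy => /forallP eq_xy.
  by apply/eqP/ffunP => i; apply/eqP.
rewrite (bigD1 i) //=; move: neq_i.
by case: (x i); case: (y i); rewrite //= ?expr1 ?expr0 ?mulr1 ?mul1r addNr mul0r.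
Qed.

Lemma sum_walsh_supersets S x :
  \sum_(T : {set 'I_n} | S \subset T) walsh R T x =
  if cube_set x \subset S then 2 ^+ (n - #|S|) * walsh R S x else 0.
Proof.
(* The second summand is the weight of leaving [i] out of [T]; it vanishes on [S], so only supersets
   of [S] survive. *)
transitivity (\prod_(i < n) ((-1) ^+ x i + (i \notin S)%:R) : R).
  rewrite bigA_distr big_mkcond; apply: eq_bigr => T _.
  rewrite walshE; case: ifPn => [sST|/subsetPn [i Si Ti]].
    rewrite [LHS]big_mkcond; apply: eq_bigr => i _.
    by case: ifPn => // Ti; rewrite (contra (subsetP sST i)).
  by rewrite (bigD1 i) //= (negPf Ti) Si mul0r.
(* A point with a coordinate 1 outside [S] yields a factor [-1 + 1]. *)
case: ifPn => [sxS|/subsetPn [i xi Si]]; last first.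
  by move: xi; rewrite inE (bigD1 i) //= Si => ->; rewrite addNr mul0r.
rewrite (bigID (mem S)) /= mulrC walshE; congr (_ * _); last first.
  by apply: eq_bigr => i Si; rewrite Si addr0.
have -> : (n - #|S| = #|~: S|)%N by rewrite [RHS]cardsCs setCK card_ord.
rewrite -prodr_const; apply: eq_big => [i|i Si]; first by rewrite !inE.
have := contra (subsetP sxS i) Si; rewrite inE => /negPf ->.
by rewrite Si.
Qed.

Lemma sum_fourier_supersets f S :
  \sum_(T : {set 'I_n} | S \subset T) fourier_coef f T =
  2 ^- #|S| * \sum_(x | cube_set x \subset S) f x * walsh R S x.
Proof.
rewrite /fourier_coef /unif_expectation exchange_big /=.
rewrite mulr_sumr [RHS]big_mkcond; apply: eq_bigr => x _.
rewrite -mulr_sumr -mulr_sumr sum_walsh_supersets.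
case: ifP => _; last by rewrite !mulr0.
(* Since [#|S| <= n], the power splits as a quotient whose numerator [2 ^+ n] cancels the mass of a
   point. *)
rewrite expfB_cond; last by rewrite pnatr_eq0 /= add0n -[leqRHS]card_ord max_card.
by rewrite mulrCA !mulrA mulfVK ?expf_neq0 ?pnatr_eq0 // [f x / _]mulrC.
Qed.

(** Squaring gives a double sum over points; summing over [S] first leaves only the diagonal, by
    [sum_walsh_mul]. *)
Lemma parseval f :
  \sum_S fourier_coef f S ^+ 2 = unif_expectation (fun x => f x ^+ 2).
Proof.
rewrite /fourier_coef /unif_expectation.
under eq_bigr do rewrite expr2 mulr_suml.
rewrite exchange_big; apply: eq_bigr => x _ /=.
under eq_bigr do rewrite mulr_sumr.
rewrite exchange_big /= (bigD1 x) //= [X in _ + X]big1 => [|y neq_yx].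
  under eq_bigr do rewrite mulrACA [X in _ * X]mulrACA mulrA.
  rewrite -mulr_sumr sum_walsh_mul eqxx addr0.
  by rewrite mulrAC mulfVK ?expf_neq0 ?pnatr_eq0 // expr2.
under eq_bigr do rewrite mulrACA [X in _ * X]mulrACA mulrA.
by rewrite -mulr_sumr sum_walsh_mul eq_sym (negPf neq_yx) mulr0.
Qed.

Lemma fourier_coef_granular f k :
  (forall x, f x \is a Num.int) ->
  (forall S, (k < #|S|)%N -> fourier_coef f S = 0) ->
  forall S, fourier_coef f S * 2 ^+ k \is a Num.int.
Proof.
move=> f_int f_low S.
have [m] := ubnP (n - #|S|); elim: m S => // m IHm S ltSm.
have [ltkS|leSk] := ltnP k #|S|; first by rewrite f_low // mul0r rpred0.
have : (\sum_(T : {set 'I_n} | S \subset T) fourier_coef f T) * 2 ^+ k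
    \is a Num.int.
  (* As [#|S| <= k], the factor [2 ^+ k] absorbs [2 ^- #|S|] and leaves an integer power of 2. *)
  rewrite sum_fourier_supersets mulrAC -{1}(subnK leSk) exprD mulrCA.
  rewrite mulVf ?expf_neq0 ?pnatr_eq0 // mulr1.
  rewrite rpredM ?rpredX ?rpred_nat // rpred_sum // => x _.
  by rewrite rpredM // rpredX // rpredN rpred1.
rewrite (bigD1 S) //= mulrDl rpredDr // mulr_suml rpred_sum // => T.
rewrite andbC eq_sym -properEneq => ltST; apply: IHm.
have ltc := proper_card ltST.
(* This gives [#|S| < n], without which the truncated difference [n - #|S|] need not decrease
   strictly. *)
have leT : (#|T| <= n)%N by rewrite -[leqRHS]card_ord max_card.
by apply: leq_trans (ltn_sub2l _ ltc) ltSm; apply: leq_trans leT.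
Qed.

(** A nonzero integer has absolute value at least 1, so [c ^+ 2] is at least [4 ^- k]. *)
Lemma log2_inv_sqr_le (c : R) k :
  c != 0 -> c * 2 ^+ k \is a Num.int -> log2 (1 / c ^+ 2) <= 2 * k%:R.
Proof.
move=> c0 cint.
have ln2 : 0 < ln (2 : R) by rewrite ln_gt0 // ltr1n.
have p2 m : (0 : R) < 2 ^+ m by rewrite exprn_gt0 // ltr0n.
have c2 : 0 < c ^+ 2 by rewrite exprn_even_gt0.
have ge1 : 1 <= `|c * 2 ^+ k|.
  by rewrite norm_intr_ge1 // mulf_neq0 // lt0r_neq0.
rewrite /log2 ler_pdivrMr // -natrM mulr_natl -lnXn ?ltr0n //.
rewrite ler_ln ?posrE ?divr_gt0 //.
rewrite ler_pdivrMr // mulnC exprM -exprMn mulrC -real_normK ?num_real //.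
by rewrite exprn_ege1.
Qed.

End Walsh.

Theorem proposition1p7 (R : realType) (n k : nat) (f : cube n -> R)
  (n_ge1 : (1 <= n)%N)
  (f_boolean : forall x : cube n, f x = -1 \/ f x = 1)
  (f_low_level : forall S : {set 'I_n}, (k < #|S|)%N -> fourier_coef f S = 0) :
  (forall S : {set 'I_n}, exists a : int, fourier_coef f S = a%:~R * 2 ^- k) /\
  spectral_entropy f <= 2 * k%:R.
Proof.
have gran : forall S, fourier_coef f S * 2 ^+ k \is a Num.int.
  apply: fourier_coef_granular => // x.
  by case: (f_boolean x) => ->; rewrite ?rpredN rpred1.
split=> [S|].
  have /intrP [a Ea] := gran S; exists a.
  by rewrite -Ea mulfK // expf_neq0 // pnatr_eq0.
have sum1 : \sum_S fourier_coef f S ^+ 2 = 1.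
  rewrite parseval /unif_expectation (eq_bigr (fun=> 2 ^- n)) => [|x _].
    rewrite sumr_const card_ffun card_bool card_ord -[LHS]mulr_natr natrX.
    by rewrite mulVf // expf_neq0 // pnatr_eq0.
  by case: (f_boolean x) => ->; rewrite ?sqrrN expr1n mulr1.
(* Spreading the bound over the weights [fourier_coef f S ^+ 2] allows a termwise comparison. *)
rewrite -[leRHS]mul1r -[X in X * _]sum1 mulr_suml /spectral_entropy big_mkcond /=.
apply: ler_sum => S _; case: ifPn => [c0|_].
  by rewrite ler_wpM2l ?sqr_ge0 // log2_inv_sqr_le.
by rewrite mulr_ge0 ?sqr_ge0 // mulr_ge0 ?ler0n.
Qed.
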